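(* Let $A$ be an alphabet. For every non-empty rooted tree $\tau$ with nodes decorated by $A$, the arborification map $\mathfrak{a}$ satisfies $$\mathfrak{a}(\tau)=\mathcal{M}_{c}\left(P_{\bullet}\otimes\mathfrak{a}\right)\curvearrowright^{*}\tau .$$
   Context: $T(A)$ is the linear span of words on $A$, with empty word $\varepsilon$ and shuffle product $\mathbin{\sqcup\!\sqcup}$ given by $\varepsilon\mathbin{\sqcup\!\sqcup} v=v\mathbin{\sqcup\!\sqcup}\varepsilon=v$, $(au)\mathbin{\sqcup\!\sqcup}(bv)=a(u\mathbin{\sqcup\!\sqcup} bv)+b(au\mathbin{\sqcup\!\sqcup} v)$ for letters $a,b$ and words $u,v$. $\mathcal{M}_c(u\otimes v)=uv$ is concatenation of words, extended linearly. $\mathcal{T}^A$ is the set of (non-planar) rooted trees with nodes decorated by elements of $A$, together with the empty tree $\mathbf{1}$; forests are commutative products of trees (the empty forest being $\mathbf{1}$). $B_+^a(\tau_1\cdots\tau_n)$ is the tree obtained by joining the roots of $\tau_1,\dots,\tau_n$ to a new root decorated by $a$; $\bullet_a=B_+^a(\mathbf{1})$ is the one-node tree. Arborification: $\mathfrak{a}$ is the linear map from forests to $T(A)$ with $\mathfrak{a}(\mathbf{1})=\varepsilon$, $\mathfrak{a}(\sigma\cdot\tau)=\mathfrak{a}(\sigma)\mathbin{\sqcup\!\sqcup}\mathfrak{a}(\tau)$ for forests, and $\mathfrak{a}(B_+^a(\tau_1\cdots\tau_n))=(\mathfrak{a}(\tau_1)\mathbin{\sqcup\!\sqcup}\cdots\mathbin{\sqcup\!\sqcup}\mathfrak{a}(\tau_n))\,a$.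 Grafting: for non-empty trees $\sigma,\tau$, $\sigma\curvearrowright\tau=\sum_{x\in N_\tau}\sigma\curvearrowright_x\tau$, where $N_\tau$ is the set of nodes of $\tau$ and $\sigma\curvearrowright_x\tau$ is obtained by connecting the root of $\sigma$ to the node $x$ of $\tau$ by a new edge; moreover $\sigma\curvearrowright\mathbf{1}=\mathbf{1}\curvearrowright\sigma=\sigma$ for all trees $\sigma$. Symmetry factor: $S(\mathbf{1})=1$, $S(B_+^a(F))=S(F)$, and $S(\tau_1^{\beta_1}\cdots\tau_n^{\beta_n})=\prod_i\beta_i!\,S(\tau_i)^{\beta_i}$ for pairwise distinct trees $\tau_i$. Inner product on the span of $\mathcal{T}^A$: $\langle\sigma,\tau\rangle=\delta_{\sigma,\tau}S(\tau)$, extended to tensor products by $\langle\sigma_1\otimes\sigma_2,\tau_1\otimes\tau_2\rangle=\langle\sigma_1,\tau_1\rangle\langle\sigma_2,\tau_2\rangle$. The map $\curvearrowright^*$ is the adjoint of grafting: $\langle\curvearrowright^*\tau,\tau_1\otimes\tau_2\rangle=\langle\tau,\tau_1\curvearrowright\tau_2\rangle$ for all trees $\tau,\tau_1,\tau_2\in\mathcal{T}^A$. $P_\bullet$ is the linear map sending $\bullet_a$ to the letter $a$ for $a\in A$ and every other tree (including $\mathbf{1}$) to $0$. *)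

(* Defs.v *)
From HB Require Import structures.
From mathcomp Require Import all_boot all_algebra.
From mathcomp Require Import finmap multiset.
From mathcomp.multinomials Require Import monalg.

Set Implicit Arguments.
Unset Strict Implicit.
Unset Printing Implicit Defensive.

Import GRing.Theory.
Local Open Scope fset_scope.
Local Open Scope ring_scope.

(* The free vector space on a basis I is {malg K[I]}, with basis vectors     *)
(* << i >>.  The tensor product of {malg K[I]} and {malg K[J]} is the free   *)
(* space {malg K[I * J]}, on the basis of pure tensors of basis vectors.     *)

(* Locked only to keep unification from unfolding it.                       *)
HB.lock Definition linext (K : fieldType) (I : choiceType) (V : lmodType K)
    (f : I -> V) (x : {malg K[I]}) : V :=
  \sum_(i <- msupp x) x@_i *: f i.
Canonical linext_unlockable := Unlockable linext.unlock.
Arguments linext {K I V} f x.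

Section LinearExtension.
Variable K : fieldType.

Definition bilext (I J : choiceType) (V : lmodType K) (f : I -> J -> V)
    (x : {malg K[I]}) (y : {malg K[J]}) : V :=
  linext (fun i => linext (f i) y) x.

Definition tens (I J : choiceType) (x : {malg K[I]}) (y : {malg K[J]}) :
    {malg K[(I * J)%type]} :=
  bilext (fun i j => << (i, j) >>) x y.

Definition tensmap (I J I' J' : choiceType)
    (f : {malg K[I]} -> {malg K[I']}) (g : {malg K[J]} -> {malg K[J']}) :
    {malg K[(I * J)%type]} -> {malg K[(I' * J')%type]} :=
  linext (fun p => tens (f << p.1 >>) (g << p.2 >>)).

End LinearExtension.

Section LinextTheory.
Variable K : fieldType.
Implicit Types I J : choiceType.

Lemma linextE I (V : lmodType K) (f : I -> V) (x : {malg K[I]}) :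
  linext f x = \sum_(i <- msupp x) x@_i *: f i.
Proof. by rewrite linext.unlock. Qed.

Lemma linextw I (V : lmodType K) (f : I -> V) (x : {malg K[I]})
    (d : {fset I}) :
  (msupp x `<=` d)%fset -> linext f x = \sum_(i <- d) x@_i *: f i.
Proof.
move=> le; rewrite linextE (big_fset_incl _ le) // => i _ /mcoeff_outdom ->.
by rewrite scale0r.
Qed.

Lemma linext_linear I (V : lmodType K) (f : I -> V) : linear (linext f).
Proof.
move=> c x y.
set d := (msupp x `|` msupp y)%fset.
have le : (msupp (c *: x + y) `<=` d)%fset.
  apply: fsubset_trans (msuppD_le _ _) _.
  by apply: fsetSU; apply: msuppZ_le.
rewrite (linextw f le) (linextw f (fsubsetUl _ _ : (msupp x `<=` d)%fset)).
rewrite (linextw f (fsubsetUr _ _ : (msupp y `<=` d)%fset)).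
rewrite scaler_sumr -big_split /=; apply: eq_bigr => i _.
by rewrite mcoeffD mcoeffZ scalerDl scalerA.
Qed.

HB.instance Definition _ I (V : lmodType K) (f : I -> V) :=
  GRing.isLinear.Build K {malg K[I]} V *:%R (linext f) (linext_linear f).

Lemma linextU I (V : lmodType K) (f : I -> V) i : linext f << i >> = f i.
Proof.
rewrite (linextw f (@msuppU_le _ _ i 1)) big_seq_fset1 mcoeffUU.
by rewrite scale1r.
Qed.

Lemma malg_scaleU I (c : K) (i : I) : << c *g i >> = c *: << i >>.
Proof. by apply/malgP=> j; rewrite mcoeffZ !mcoeffU mulrnAr mulr1. Qed.

Lemma linear_comb (U V : lmodType K) (f : U -> V) (T : Type) (s : seq T)
    (c : T -> K) (g : T -> U) :
  linear f -> f (\sum_(i <- s) c i *: g i) = \sum_(i <- s) c i *: f (g i).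
Proof.
move=> lf; elim: s => [|i s IHs]; last by rewrite !big_cons lf IHs.
by rewrite !big_nil -(addNr (0 : U)) -scaleN1r lf scaleN1r addNr.
Qed.

Lemma malgE_scale I (x : {malg K[I]}) :
  x = \sum_(i <- msupp x) x@_i *: << i >>.
Proof.
rewrite {1}[x]monalgE; apply: eq_bigr => i _; exact: malg_scaleU.
Qed.

Lemma linear_ext I (V : lmodType K) (f g : {malg K[I]} -> V) :
  linear f -> linear g -> (forall i, f << i >> = g << i >>) -> f =1 g.
Proof.
move=> lf lg fg x; rewrite [x]malgE_scale !linear_comb //.
by apply: eq_bigr => i _; rewrite fg.
Qed.

Lemma bilextU I J (V : lmodType K) (f : I -> J -> V) i j :
  bilext f << i >> << j >> = f i j.
Proof. by rewrite /bilext !linextU. Qed.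

Lemma bilext_linl I J (V : lmodType K) (f : I -> J -> V) y :
  linear (bilext f ^~ y).
Proof. exact: linext_linear. Qed.

Lemma bilext_linr I J (V : lmodType K) (f : I -> J -> V) x :
  linear (bilext f x).
Proof.
move=> c y z; rewrite /bilext !(linextE _ x).
rewrite scaler_sumr -big_split /=.
apply: eq_bigr => i _.
by rewrite linext_linear scalerDr !scalerA mulrC.
Qed.

Lemma tensU I J (i : I) (j : J) :
  tens << i >> << j >> = << (i, j) >> :> {malg K[(I * J)%type]}.
Proof. exact: bilextU. Qed.

End LinextTheory.

Section Words.
Variables (K : fieldType) (A : choiceType).

Definition Mc : {malg K[(seq A * seq A)%type]} -> {malg K[seq A]} :=
  linext (fun p => << p.1 ++ p.2 >>).

Definition conc (x y : {malg K[seq A]}) : {malg K[seq A]} := Mc (tens x y).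

Definition letter (a : A) : {malg K[seq A]} := << [:: a] >>.

Definition eps : {malg K[seq A]} := << [::] >>.

Fixpoint shuffle_word (u : seq A) : seq A -> {malg K[seq A]} :=
  match u with
  | [::] => fun v => << v >>
  | a :: u' =>
      fix shuffle_u (v : seq A) : {malg K[seq A]} :=
        match v with
        | [::] => << u >>
        | b :: v' => conc (letter a) (shuffle_word u' v)
                     + conc (letter b) (shuffle_u v')
        end
  end.

Definition shuffle : {malg K[seq A]} -> {malg K[seq A]} -> {malg K[seq A]} :=
  bilext shuffle_word.

End Words.

Arguments eps {K A}.

(* Planar decorated trees, used as representatives of non-planar ones.       *)
Inductive ptree (A : Type) : Type := Node of A & seq (ptree A).

Section PlanarTrees.
Variable A : Type.
Implicit Types t u : ptree A.

Definition proot t := let: Node a _ := t in a.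
Definition pchildren t := let: Node _ f := t in f.

Lemma ptree_ind' (P : ptree A -> Prop) :
  (forall a f, foldr (fun t Q => P t /\ Q) True f -> P (Node a f)) ->
  forall t, P t.
Proof.
move=> IH; fix rec 1 => -[a f]; apply: IH.
by elim: f => [//|t f IHf]; split; [apply: rec|exact: IHf].
Qed.

Fixpoint psize t : nat := let: Node _ f := t in (sumn (map psize f)).+1.

Fixpoint plabels t : seq A :=
  let: Node a f := t in a :: flatten (map plabels f).

(* A node is given by its address, the list of child positions on the path   *)
(* from the root to it.                                                      *)
Fixpoint nodes t : seq (seq nat) :=
  let: Node _ f := t in
  let ns := map nodes f in
  [::] :: flatten [seq [seq i :: x | x <- nth [::] ns i] | i <- iota 0 (size ns)].

Fixpoint graft_at s (x : seq nat) t : ptree A :=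
  let: Node a f := t in
  match x with
  | [::] => Node a (s :: f)
  | i :: x' => Node a (set_nth t f i (graft_at s x' (nth t f i)))
  end.

Fixpoint ptree_encode t : GenTree.tree A :=
  let: Node a f := t in GenTree.Node 0 (GenTree.Leaf a :: map ptree_encode f).

Fixpoint ptree_decode (g : GenTree.tree A) : option (ptree A) :=
  match g with
  | GenTree.Node _ (GenTree.Leaf a :: f) =>
      Some (Node a (pmap ptree_decode f))
  | _ => None
  end.

Lemma ptree_encodeK : pcancel ptree_encode ptree_decode.
Proof.
elim/ptree_ind' => a f IH /=; congr (Some (Node a _)).
by elim: f IH => [//|t f IHf] /= [-> /IHf ->].
Qed.

End PlanarTrees.

HB.instance Definition _ (A : choiceType) :=
  Choice.copy (ptree A) (pcan_type (@ptree_encodeK A)).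

Section NonPlanarTrees.
Variable A : choiceType.

(* Sorts the children at every node into an order that depends only on the   *)
(* multiset of the sorted children, so that two planar trees are isomorphic  *)
(* as non-planar trees iff they have the same normal form; see               *)
(* [ntree_piE] below.                                                        *)
Fixpoint pnorm (t : ptree A) : ptree A :=
  let: Node a f := t in
  let g := map pnorm f in Node a (choose (perm_eq g) g).

Definition piso (t u : ptree A) : bool := pnorm t == pnorm u.

Lemma piso_refl : reflexive piso. Proof. by move=> t; apply: eqxx. Qed.
Lemma piso_sym : symmetric piso. Proof. by move=> t u; apply: eq_sym. Qed.
Lemma piso_trans : transitive piso.
Proof. by move=> u t v /eqP tu /eqP uv; apply/eqP; rewrite tu. Qed.

Canonical piso_equiv := EquivRel piso piso_refl piso_sym piso_trans.

(* Non-empty rooted trees decorated by A. *)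
Definition ntree := {eq_quot piso}%qT.
HB.instance Definition _ := Choice.on ntree.
HB.instance Definition _ := EqQuotient.on ntree.

(* None is the empty tree. *)
Definition tree := option ntree.
HB.instance Definition _ := Choice.on tree.

End NonPlanarTrees.

Notation forest A := {mset ntree A}%mset.

Section NonPlanarTheory.
Variable A : choiceType.
Implicit Types (t u : ptree A) (f g : seq (ptree A)) (F G : forest A).

Notation pi := (\pi_(ntree A))%qT.

Lemma pi_eqE t u : (pi t == pi u) = (pnorm t == pnorm u).
Proof. exact/eqmodE. Qed.

Lemma perm_choose (T : choiceType) (s1 s2 : seq T) :
  (choose (perm_eq s1) s1 == choose (perm_eq s2) s2) = perm_eq s1 s2.
Proof.
apply/eqP/idP => [eq12|eq12].
  have p1 : perm_eq s1 (choose (perm_eq s1) s1) by exact: chooseP.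
  have p2 : perm_eq s2 (choose (perm_eq s2) s2) by exact: chooseP.
  by rewrite (perm_trans p1) // eq12 perm_sym.
rewrite (@eq_choose _ (perm_eq s1) (perm_eq s2)); last first.
  by move=> s; apply/permPl: s.
by apply: choose_id => //; rewrite perm_sym.
Qed.

(* Two planar trees represent the same non-planar tree iff they have the     *)
(* same root decoration and the same multiset of non-planar subtrees.        *)
Lemma ntree_piE a f b g :
  (pi (Node a f) == pi (Node b g)) = (a == b) && perm_eq (map pi f) (map pi g).
Proof.
pose h (x : ntree A) := pnorm (repr x).
have hE s : map (@pnorm A) s = map h (map pi s).
  rewrite -map_comp; apply: eq_map => t; apply/eqP.
  by rewrite /= /h -pi_eqE reprK.
have h_inj : injective h.
  by move=> x y /eqP; rewrite -pi_eqE !reprK => /eqP.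
have -> : perm_eq (map pi f) (map pi g)
    = perm_eq (map (@pnorm A) f) (map (@pnorm A) g).
  by rewrite !hE; apply/idP/idP => [/perm_map->//|/(perm_map_inj h_inj)].
rewrite pi_eqE /= -perm_choose.
by apply/eqP/andP => [[-> ->]|[/eqP-> /eqP->]].
Qed.

Definition Bplus (a : A) F : ntree A := pi (Node a (map repr F)).

Definition bullet (a : A) : ntree A := Bplus a mset0.

Lemma BplusE a f : Bplus a (seq_mset (map pi f)) = pi (Node a f).
Proof.
apply/eqP; rewrite ntree_piE eqxx -map_comp /=.
rewrite (eq_map (fun x => reprK x : (pi \o repr) x = id x)) map_id.
exact: perm_eq_seq_mset.
Qed.

Lemma Bplus_inj a F b G : Bplus a F = Bplus b G -> a = b /\ F = G.
Proof.
move/eqP; rewrite ntree_piE -!map_comp.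
rewrite !(eq_map (fun x => reprK x : (pi \o repr) x = id x)) !map_id.
by case/andP=> /eqP-> /eq_seq_msetP; rewrite !seq_mset_id.
Qed.

Lemma Bplus_surj (x : ntree A) : exists a F, x = Bplus a F.
Proof.
elim/quotW: x => -[a f]; exists a, (seq_mset (map pi f)).
by rewrite BplusE.
Qed.

Lemma pi_invariant (V : eqType) (phi : ptree A -> V) :
  (forall a f g, perm_eq (map pi f) (map pi g) ->
     perm_eq (map phi f) (map phi g) -> phi (Node a f) = phi (Node a g)) ->
  forall t u, pi t = pi u -> phi t = phi u.
Proof.
move=> phiE; elim/ptree_ind' => a f IH [b g] /eqP.
rewrite ntree_piE => /andP[/eqP <- fg]; apply: phiE => //.
have IHf t : t \in f -> forall u, pi t = pi u -> phi t = phi u.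
  elim: f IH {fg} => [//|t' f IHf] /= [IHt /IHf{}IHf].
  by rewrite inE => /predU1P[->|/IHf].
have mapE s : {subset map pi s <= map pi f} ->
    map phi s = map (phi \o repr) (map pi s).
  move=> sf; rewrite -map_comp; apply/eq_in_map => u us /=.
  have /mapP[t tf tu] := sf _ (map_f _ us).
  by rewrite -(IHf t tf u) // -(IHf t tf (repr (pi u))) // reprK.
rewrite !mapE //; first exact: perm_map.
by move=> x; rewrite (perm_mem fg).
Qed.

Definition forest_of_tree (x : tree A) : forest A :=
  if x is Some y then [mset y]%mset else mset0.

Definition nroot (x : ntree A) : A := proot (repr x).

Lemma nroot_Bplus a F : nroot (Bplus a F) = a.
Proof.
rewrite /nroot; case E : (repr _) => [b g] /=.
by have /eqP := reprK (Bplus a F); rewrite E ntree_piE => /andP[/eqP].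
Qed.

(* The symmetry factor of B_+^a(t_1 ... t_n), grouping the t_i by            *)
(* isomorphism class; see [sym_Bplus].                                       *)
Fixpoint psym t : nat :=
  let: Node _ f := t in
  ((\prod_(x <- undup (map pi f)) (count_mem x (map pi f))`!)
   * foldr muln 1 (map psym f))%N.

Definition sym_ntree (x : ntree A) : nat := psym (repr x).

Definition sym_tree (x : tree A) : nat :=
  if x is Some y then sym_ntree y else 1%N.

Definition sym_forest F : nat :=
  (\prod_(x <- finsupp F) ((F x)`! * sym_ntree x ^ F x))%N.

Lemma psym_pi t : sym_ntree (pi t) = psym t.
Proof.
apply: (@pi_invariant nat psym) (reprK (pi t)).
move=> a f g fg Sfg /=; congr (_ * _)%N.
  rewrite (perm_big (undup (map pi g))) /=; last first.
    by apply: uniq_perm; rewrite ?undup_uniq // => x;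
       rewrite !mem_undup (perm_mem fg).
  by apply: eq_bigr => x _; rewrite (permP fg).
by rewrite !foldrE; apply: perm_big.
Qed.

Lemma sym_Bplus a F : sym_ntree (Bplus a F) = sym_forest F.
Proof.
have mapK : map pi (map repr F) = F.
  rewrite -map_comp (eq_map (fun x => reprK x : (pi \o repr) x = id x)).
  by rewrite map_id.
rewrite /Bplus psym_pi /= mapK /sym_forest big_split /=; congr (_ * _)%N.
  rewrite (perm_big _ (perm_undup_mset F)) /=.
  by apply: eq_bigr => x _; rewrite count_mem_mset.
by rewrite -map_comp foldrE big_map prod_mset.
Qed.

Lemma psym_gt0 t : (0 < psym t)%N.
Proof.
elim/ptree_ind': t => a f IH /=; rewrite muln_gt0; apply/andP; split.
  by apply: prodn_gt0 => x; apply: fact_gt0.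
by elim: f IH => [//|t f IHf] /= [? /IHf]; rewrite muln_gt0 => ->; apply/andP.
Qed.

Lemma sym_tree_gt0 x : (0 < sym_tree x)%N.
Proof. by case: x => [x|//]; apply: psym_gt0. Qed.

Lemma psize_pi t u : pi t = pi u -> psize t = psize u.
Proof.
apply: pi_invariant => a f g _ fg /=; congr _.+1.
exact: perm_sumn.
Qed.

Lemma plabels_pi t u : pi t = pi u -> plabels t =i plabels u.
Proof.
move=> tu c; apply: (@pi_invariant bool (fun t => c \in plabels t)) tu.
move=> a f g _ fg /=; rewrite !inE; congr (_ || _).
have E s : (c \in flatten (map (@plabels A) s))
    = has id (map (fun t => c \in plabels t) s).
  by elim: s => [//|v s IHs] /=; rewrite mem_cat IHs.
by rewrite !E (perm_has _ fg).
Qed.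

End NonPlanarTheory.

Section Grafting.
Variables (K : fieldType) (A : choiceType).
Implicit Types x y z : tree A.

Notation pi := (\pi_(ntree A))%qT.

Definition graft x y : {malg K[tree A]} :=
  match x, y with
  | Some s, Some t =>
      \sum_(v <- nodes (repr t)) << Some (pi (graft_at (repr s) v (repr t))) >>
  | None, _ => << y >>
  | _, None => << x >>
  end.

Definition inner_basis x y : K := (x == y)%:R * (sym_tree y)%:R.

Definition inner (x y : {malg K[tree A]}) : K :=
  bilext (inner_basis : _ -> _ -> K^o) x y.

Definition inner2 (x y : {malg K[(tree A * tree A)%type]}) : K :=
  bilext (fun p q => inner_basis p.1 q.1 * inner_basis p.2 q.2 : K^o) x y.

(* All sequences of length at most n over s. *)
Fixpoint seqs_upto (T : Type) (n : nat) (s : seq T) : seq (seq T) :=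
  if n is n'.+1 then [::] :: [seq i :: l | i <- s, l <- seqs_upto n' s]
  else [:: [::]].

(* All planar trees decorated by L of height and arity at most h and n. *)
Fixpoint ptrees_upto (L : seq A) (n h : nat) : seq (ptree A) :=
  if h is h'.+1 then
    [seq Node a f | a <- L, f <- seqs_upto n (ptrees_upto L n h')]
  else [::].

(* A finite set of trees containing every tree that has at most as many      *)
(* nodes as z and is decorated by decorations of z.                          *)
Definition trees_upto z : seq (tree A) :=
  None :: if z is Some w then
            [seq Some (pi t) | t <- ptrees_upto (plabels (repr w))
                                     (psize (repr w)) (psize (repr w))]
          else [::].

(* The adjoint of grafting: its coefficient on x (x) y is                    *)
(* <z, graft x y> / (S(x) S(y)), where z is the argument. The finite set     *)
(* trees_upto z only serves to give a finite sum: the coefficient is 0       *)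
(* outside it. See [graft_adjP] and [graft_adj_unique].                      *)
Definition graft_adj z : {malg K[(tree A * tree A)%type]} :=
  [malg p in [fset p in [seq (x, y) | x <- trees_upto z, y <- trees_upto z]] =>
     inner << z >> (graft p.1 p.2) / ((sym_tree p.1)%:R * (sym_tree p.2)%:R)].

End Grafting.

Section GraftingTheory.
Variables (K : fieldType) (A : choiceType).
Implicit Types x y z : tree A.

Notation pi := (\pi_(ntree A))%qT.

Lemma nodesP (a : A) f v :
  reflect (v = [::] \/ exists i w, [/\ v = i :: w, (i < size f)%N &
             forall t, w \in nodes (nth t f i)])
          (v \in nodes (Node a f)).
Proof.
rewrite /= inE size_map; apply: (iffP orP) => -[].
- by move/eqP; left.
- case/flatten_mapP=> i; rewrite mem_iota add0n => /= lt_i /mapP[w wi ->].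
  right; exists i, w; split=> // t; by rewrite (nth_map t) in wi.
- by move=> ->; left.
- case=> i [w [-> lt_i wi]]; right; apply/flatten_mapP; exists i.
    by rewrite mem_iota.
  by rewrite map_f // (nth_map (Node a f)).
Qed.

Lemma graft_at_size s v (t : ptree A) :
  v \in nodes t -> psize (graft_at s v t) = (psize s + psize t)%N.
Proof.
elim/ptree_ind': t v => a f IH v.
case/nodesP => [->|[i [w [-> lt_i wi]]]] /=; first by rewrite addnS.
rewrite addnS; congr _.+1.
have {}IH : forall t', psize (graft_at s w (nth t' f i))
    = (psize s + psize (nth t' f i))%N.
  move=> t'; move: (wi t'); elim: f i lt_i IH {wi} => [//|t f IHf] [|i] /=.
    by move=> _ [IH _]; apply: IH.
  by move=> lt_i [_ /(IHf i lt_i)].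
move: {wi} (Node a f) (IH (Node a f)) => d; clear IH.
elim: f i lt_i => [//|t f IHf] [|i] /= lt_i E; first by rewrite E addnA.
by rewrite (IHf i) // addnCA.
Qed.

Lemma graft_at_labels s v (t : ptree A) :
  v \in nodes t -> perm_eq (plabels (graft_at s v t)) (plabels s ++ plabels t).
Proof.
elim/ptree_ind': t v => a f IH v.
case/nodesP => [->|[i [w [-> lt_i wi]]]] /=.
  by apply/permP => P; rewrite /= !count_cat /= addnCA.
have {}IH : forall t', perm_eq (plabels (graft_at s w (nth t' f i)))
    (plabels s ++ plabels (nth t' f i)).
  move=> t'; move: (wi t'); elim: f i lt_i IH {wi} => [//|t f IHf] [|i] /=.
    by move=> _ [IH _]; apply: IH.
  by move=> lt_i [_ /(IHf i lt_i)].
move: {wi} (Node a f) (IH (Node a f)) => d; clear IH => E.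
apply/permP => P; rewrite /= count_cat /= addnCA; congr (_ + _)%N.
elim: f i lt_i E => [//|t f IHf] [|i] /= lt_i E; rewrite !count_cat.
  by rewrite (permP E) count_cat addnA.
by rewrite (IHf i) // addnCA.
Qed.

Lemma mem_seqs_upto (T : eqType) n (s l : seq T) :
  (size l <= n)%N -> {subset l <= s} -> l \in seqs_upto n s.
Proof.
elim: n l => [|n IHn] [|c l] //= le_l sl.
rewrite inE; apply/orP; right; apply: allpairs_f; first by rewrite sl ?mem_head.
by apply: IHn => // c' c'l; rewrite sl // inE c'l orbT.
Qed.

Lemma mem_ptrees_upto (L : seq A) n h t :
  (psize t <= n)%N -> (psize t <= h)%N -> {subset plabels t <= L} ->
  t \in ptrees_upto L n h.
Proof.
elim: h t => [|h IHh] [a f] //= le_n; rewrite ltnS => le_h sL.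
apply: allpairs_f; first by rewrite sL ?mem_head.
have le_sz t : t \in f -> (psize t <= sumn (map (@psize A) f))%N.
  elim: f {le_n le_h sL} => [//|u f IHf] /=; rewrite inE => /predU1P[->|/IHf].
    exact: leq_addr.
  by move/leq_trans; apply; apply: leq_addl.
apply: mem_seqs_upto.
  apply: leq_trans (ltnW le_n); elim: f {le_n le_h sL le_sz} => [//|u f IHf] /=.
  by rewrite -add1n leq_add //; case: u.
move=> t tf; apply: IHh.
- by apply: leq_trans (ltnW le_n); apply: le_sz.
- by apply: leq_trans le_h; apply: le_sz.
- move=> c ct; apply: sL; rewrite inE; apply/orP; right.
  by apply/flattenP; exists (plabels t) => //; apply: map_f.
Qed.

Lemma innerU x y : inner << x >> << y >> = inner_basis K x y.
Proof. by rewrite /inner (@bilextU K _ _ K^o). Qed.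

Lemma inner2_tensU x1 x2 y1 y2 :
  inner2 (tens << x1 >> << x2 >>) (tens << y1 >> << y2 >>)
  = inner << x1 >> << y1 >> * inner << x2 >> << y2 >> :> K.
Proof. by rewrite !tensU /inner2 bilextU !innerU. Qed.

Lemma graft_outside x y z : inner << z >> (graft K x y) != 0 ->
  (x \in trees_upto z) && (y \in trees_upto z).
Proof.
have self (w : tree A) : w \in trees_upto w.
  case: w => [w|//]; rewrite inE; apply/orP; right; apply/mapP.
  by exists (repr w); rewrite ?reprK //; apply: mem_ptrees_upto.
have basis (u v : tree A) : inner << u >> << v >> != 0 :> K -> u = v.
  by rewrite innerU /inner_basis; have [//|_] := eqVneq u v; rewrite mul0r eqxx.
case: x y => [s|] [t|] /=; try by move/basis => <-; rewrite ?self ?mem_head.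
have lin : linear (inner << z >> : {malg K[tree A]} -> K^o).
  exact: bilext_linr.
pose T v := Some (pi (graft_at (repr s) v (repr t))) : tree A.
rewrite -/T; have -> : \sum_(v <- nodes (repr t)) << T v >>
   = \sum_(v <- nodes (repr t)) (1 : K) *: (<< T v >> : {malg K[tree A]}).
  by apply: eq_bigr => v _; rewrite scale1r.
rewrite (linear_comb _ (fun=> 1) _ lin) => nz.
have [v vt /basis zE] : exists2 v, v \in nodes (repr t) &
    inner << z >> << T v >> != 0 :> K.
  apply/hasP; apply: contraNT nz => /hasPn z0; apply/eqP.
  rewrite big_seq big1 // => v /z0; rewrite negbK => /eqP ->; exact: scaler0.
have sz := graft_at_size (repr s) vt.
have lb := perm_mem (graft_at_labels (repr s) vt).
have E := reprK (pi (graft_at (repr s) v (repr t))).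
rewrite zE /T !inE /=; set w := repr _ in E *.
rewrite -(psize_pi E) in sz; rewrite sz.
have lbw c : c \in plabels w = (c \in plabels (repr s) ++ plabels (repr t)).
  by rewrite (plabels_pi E) lb.
apply/andP; split; apply/mapP; [exists (repr s)|exists (repr t)];
  rewrite ?reprK //; apply: mem_ptrees_upto; rewrite ?leq_addr ?leq_addl //;
  by move=> c cs; rewrite lbw mem_cat cs ?orbT.
Qed.

Lemma sym_tree_neq0 x : [pchar K] =i pred0 -> (sym_tree x)%:R != 0 :> K.
Proof. by move/pcharf0P->; rewrite -lt0n sym_tree_gt0. Qed.

Lemma inner2_coef (g : {malg K[(tree A * tree A)%type]}) x y :
  inner2 g (tens << x >> << y >>)
  = g@_(x, y) * ((sym_tree x)%:R * (sym_tree y)%:R).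
Proof.
rewrite tensU /inner2 /bilext.
have -> : g@_(x, y) * ((sym_tree x)%:R * (sym_tree y)%:R) =
    linext (fun p => (p == (x, y))%:R * ((sym_tree x)%:R * (sym_tree y)%:R)
      : K^o) g.
  rewrite (linextw _ (fsubsetUl _ [fset (x, y)] : (msupp g `<=` _)%fset)).
  rewrite (big_fsetD1 (x, y)) ?inE ?eqxx ?orbT //= mul1r big1_fset ?addr0 //.
  by move=> p; rewrite !inE => /andP[/negPf-> _] _; rewrite mul0r scaler0.
rewrite !linextE; apply: eq_bigr => -[p q] _.
rewrite linextU /inner_basis /= xpair_eqE mulrACA.
by rewrite -mulnb natrM.
Qed.

(* graft_adj is the adjoint of grafting, and the only one.                   *)
Lemma graft_adjP (charK : [pchar K] =i pred0) z x y :
  inner2 (graft_adj K z) (tens << x >> << y >>) = inner << z >> (graft K x y).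
Proof.
rewrite inner2_coef /graft_adj mcoeffE in_fset.
case: ifPn => [_|out].
  by rewrite mulfVK // mulf_neq0 // sym_tree_neq0.
rewrite mul0r; apply/esym/eqP; apply: contraNT out => /graft_outside/andP[xz yz].
by apply/allpairsP; exists (x, y).
Qed.

Lemma graft_adj_unique (charK : [pchar K] =i pred0)
    (gadj : tree A -> {malg K[(tree A * tree A)%type]}) :
  (forall z x y,
     inner2 (gadj z) (tens << x >> << y >>) = inner << z >> (graft K x y)) ->
  gadj =1 @graft_adj K A.
Proof.
move=> gadjP z; apply/malgP => -[x y].
have nz : (sym_tree x)%:R * (sym_tree y)%:R != 0 :> K.
  by rewrite mulf_neq0 // sym_tree_neq0.
by apply: (mulIf nz); rewrite -!inner2_coef gadjP graft_adjP.
Qed.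

End GraftingTheory.

Section ShuffleTheory.
Variables (K : fieldType) (A : choiceType).
Local Notation TA := {malg K[seq A]}.
Implicit Types (x y z : TA) (a b c : A) (u v w : seq A).

Lemma conc_linl y : linear (fun x : TA => conc x y).
Proof. by move=> c x x'; rewrite /conc /tens bilext_linl [Mc _]linext_linear. Qed.

Lemma conc_linr x : linear (conc x : TA -> TA).
Proof. by move=> c y y'; rewrite /conc /tens bilext_linr [Mc _]linext_linear. Qed.

Lemma shuffle_linl y : linear (fun x : TA => shuffle x y).
Proof. exact: bilext_linl. Qed.

Lemma shuffle_linr x : linear (shuffle x : TA -> TA).
Proof. exact: bilext_linr. Qed.

Lemma linD (U V : lmodType K) (f : U -> V) :
  linear f -> {morph f : p q / p + q}.
Proof. by move=> lf p q; have := lf 1 p q; rewrite !scale1r. Qed.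

Lemma concU u v : conc << u >> << v >> = << u ++ v >> :> TA.
Proof. by rewrite /conc tensU [Mc _]linextU. Qed.

Lemma letter_cons a u : << a :: u >> = conc (letter K a) << u >>.
Proof. by rewrite concU. Qed.

Lemma shuffleU u v : shuffle << u >> << v >> = shuffle_word K u v.
Proof. exact: bilextU. Qed.

Lemma shuffle_letter a b x y :
  shuffle (conc (letter K a) x) (conc (letter K b) y)
  = conc (letter K a) (shuffle x (conc (letter K b) y))
    + conc (letter K b) (shuffle (conc (letter K a) x) y).
Proof.
move: x; apply: linear_ext => [k p q|k p q|u].
- by rewrite conc_linr shuffle_linl.
- by rewrite !(conc_linr, shuffle_linl) scalerDr addrACA.
move: y; apply: linear_ext => [k p q|k p q|v].
- by rewrite conc_linr shuffle_linr.
- by rewrite !(conc_linr, shuffle_linr) scalerDr addrACA.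
by rewrite -!letter_cons !shuffleU.
Qed.

Lemma shuffle1x : left_id (eps : TA) (@shuffle K A).
Proof.
apply: linear_ext => [||u]; [exact: shuffle_linr|by []|].
by rewrite shuffleU.
Qed.

Lemma shufflex1 : right_id (eps : TA) (@shuffle K A).
Proof.
apply: linear_ext => [||u]; [exact: shuffle_linl|by []|].
by rewrite shuffleU; case: u.
Qed.

Let shuffleC_step a b x y x' y' :
  x' = conc (letter K a) x -> y' = conc (letter K b) y ->
  shuffle x y' = shuffle y' x -> shuffle x' y = shuffle y x' ->
  shuffle x' y' = shuffle y' x'.
Proof.
set la := conc (letter K a); set lb := conc (letter K b) => xE yE Hx Hy.
have -> : shuffle x' y' = la (shuffle x y') + lb (shuffle x' y).
  by rewrite xE yE; apply: shuffle_letter.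
have -> : shuffle y' x' = lb (shuffle y x') + la (shuffle y' x).
  by rewrite xE yE; apply: shuffle_letter.
rewrite Hx. rewrite Hy. exact: addrC.
Qed.

Lemma shuffleC : commutative (@shuffle K A).
Proof.
move=> x y; move: x.
apply: linear_ext => [||u]; [exact: shuffle_linl|exact: shuffle_linr|].
move: y; apply: linear_ext => [||v]; [exact: shuffle_linr|exact: shuffle_linl|].
elim: u v => [|a u IHu] v; first by rewrite shuffle1x shufflex1.
elim: v => [|b v IHv]; first by rewrite shuffle1x shufflex1.
apply: (@shuffleC_step a b << u >> << v >>).
- exact: letter_cons.
- exact: letter_cons.
- exact: IHu.
- exact: IHv.
Qed.

Let shuffleA_step a b c x y z x' y' z' :
  x' = conc (letter K a) x -> y' = conc (letter K b) y ->
  z' = conc (letter K c) z ->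
  shuffle x (shuffle y' z') = shuffle (shuffle x y') z' ->
  shuffle x' (shuffle y z') = shuffle (shuffle x' y) z' ->
  shuffle x' (shuffle y' z) = shuffle (shuffle x' y') z ->
  shuffle x' (shuffle y' z') = shuffle (shuffle x' y') z'.
Proof.
set la := conc (letter K a); set lb := conc (letter K b).
set lc := conc (letter K c); move=> xE yE zE Hx Hy Hz.
have laD : {morph la : p q / p + q} by apply: linD; apply: conc_linr.
have lcD : {morph lc : p q / p + q} by apply: linD; apply: conc_linr.
have L p q : shuffle x' (lb p + lc q)
    = la (shuffle x (lb p + lc q)) + (lb (shuffle x' p) + lc (shuffle x' q)).
  rewrite !(linD (shuffle_linr _)) xE (shuffle_letter a b) (shuffle_letter a c).
  by rewrite addrACA -laD.
have R p q : shuffle (la p + lb q) z'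
    = la (shuffle p z') + lb (shuffle q z') + lc (shuffle (la p + lb q) z).
  rewrite !(linD (shuffle_linl _)) zE (shuffle_letter a c) (shuffle_letter b c).
  by rewrite addrACA -lcD.
have yz : shuffle y' z' = lb (shuffle y z') + lc (shuffle y' z).
  by rewrite zE yE; apply: shuffle_letter.
have xy : shuffle x' y' = la (shuffle x y') + lb (shuffle x' y).
  by rewrite xE yE; apply: shuffle_letter.
by rewrite {1}yz L -yz xy R -xy Hx Hy Hz addrA.
Qed.

Lemma shuffleA : associative (@shuffle K A).
Proof.
move=> x y z; move: x; apply: linear_ext => [|k p q|u].
- exact: shuffle_linl.
- by rewrite !shuffle_linl.
move: y; apply: linear_ext => [k p q|k p q|v].
- by rewrite shuffle_linl shuffle_linr.
- by rewrite shuffle_linr shuffle_linl.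
move: z; apply: linear_ext => [k p q||w].
- by rewrite !shuffle_linr.
- exact: shuffle_linr.
elim: u v w => [|a u IHu] v w; first by rewrite !shuffle1x.
elim: v w => [|b v IHv] w; first by rewrite shuffle1x shufflex1.
elim: w => [|c w IHw]; first by rewrite !shufflex1.
apply: (@shuffleA_step a b c << u >> << v >> << w >>).
- exact: letter_cons.
- exact: letter_cons.
- exact: letter_cons.
- exact: IHu.
- exact: IHv.
- exact: IHw.
Qed.

HB.instance Definition _ := Monoid.isComLaw.Build TA eps (@shuffle K A)
  shuffleA shuffleC shuffle1x.

End ShuffleTheory.

Section Arborification.
Variables (K : fieldType) (A : choiceType).
Local Notation TA := {malg K[seq A]}.
Notation pi := (\pi_(ntree A))%qT.

(* See [arborification0], [arborificationD] and [arborification_Bplus] for   *)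
(* the defining equations on non-planar forests.                             *)
Fixpoint arbor_ptree (t : ptree A) : TA :=
  let: Node a f := t in
  conc (foldr (@shuffle K A) eps (map arbor_ptree f)) (letter K a).

Definition arbor_ntree (x : ntree A) : TA := arbor_ptree (repr x).

Definition arbor_forest (F : forest A) : TA :=
  \big[@shuffle K A/eps]_(x <- F) arbor_ntree x.

Definition arborification : {malg K[forest A]} -> TA := linext arbor_forest.

Definition arborification_tree : {malg K[tree A]} -> TA :=
  linext (fun x => arborification << forest_of_tree x >>).

Definition Pbullet : {malg K[tree A]} -> TA :=
  linext (fun x => if x is Some y then
                     if y == bullet (nroot y) then letter K (nroot y) else 0
                   else 0).

Lemma arbor_pi t : arbor_ntree (pi t) = arbor_ptree t.
Proof.
apply: (@pi_invariant _ TA arbor_ptree) (reprK (pi t)) => a f g _ fg /=.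
by rewrite !foldrE (perm_big _ fg).
Qed.

Lemma arborificationU F : arborification << F >> = arbor_forest F.
Proof. exact: linextU. Qed.

Lemma arborification0 : arborification << mset0 >> = eps.
Proof. by rewrite arborificationU /arbor_forest big_mset0. Qed.

Lemma arborificationD (F G : forest A) :
  arborification << (F `+` G)%mset >>
  = shuffle (arborification << F >>) (arborification << G >>).
Proof.
have FG : perm_eq (F `+` G)%mset (F ++ G).
  rewrite /perm_eq; apply/allP => x _ /=.
  by rewrite count_cat !count_mem_mset msetE2.
apply: etrans (arborificationU _) _; apply: etrans (perm_big _ FG) _.
apply: etrans (big_cat _ _ _ _ _) _.
by congr (shuffle _ _); apply/esym/arborificationU.
Qed.

Lemma arborification_Bplus a (F : forest A) :
  arborification << [mset Bplus a F]%mset >>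
  = conc (arborification << F >>) (letter K a).
Proof.
apply: etrans (arborificationU _) _.
apply: etrans _ (congr1 (@conc K A ^~ _) (esym (arborificationU _))).
rewrite /arbor_forest big_msetn /= arbor_pi /=.
by rewrite foldrE -map_comp big_map.
Qed.

Lemma PbulletE a : Pbullet << Some (bullet a) >> = letter K a.
Proof. by rewrite /Pbullet linextU nroot_Bplus eqxx. Qed.

Lemma Pbullet0 x : (forall a, x <> Some (bullet a)) -> Pbullet << x >> = 0.
Proof.
rewrite /Pbullet linextU; case: x => [y|//] nb.
by case: eqP => // yE; case: (nb (nroot y)); rewrite -yE.
Qed.

End Arborification.

Section GraftRepr.
Variables (K : fieldType) (A : choiceType).
Implicit Types (s t : ptree A) (f : seq (ptree A)).

Notation pi := (\pi_(ntree A))%qT.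

Let map_pi_set_nth d f i t t' : pi t = pi t' ->
  map pi (set_nth d f i t) = map pi (set_nth d f i t').
Proof.
move=> tt'; elim: f i => [|u f IHf] [|i] /=; rewrite ?tt' ?IHf //.
by congr (_ :: _); elim: i => [|i IHi] /=; rewrite ?tt' ?IHi.
Qed.

Let pi_graft_at s s' v t : pi s = pi s' ->
  pi (graft_at s v t) = pi (graft_at s' v t).
Proof.
move=> ss'; elim: v t => [|i v IHv] [a f] /=; apply/eqP.
  by rewrite ntree_piE eqxx /= ss' perm_refl.
by rewrite ntree_piE eqxx /= (map_pi_set_nth _ _ _ (IHv _)) perm_refl.
Qed.

Let grafts s t : seq (ntree A) := [seq pi (graft_at s v t) | v <- nodes t].

(* The trees obtained by replacing one subtree x by each tree of l.          *)
Let regraft a (M : forest A) (p : ntree A * forest A) : seq (ntree A) :=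
  [seq Bplus a (y +` (M `\ p.1))%mset | y <- p.2].

Let seq_mset_set_nth f i t d : (i < size f)%N ->
  seq_mset (map pi (set_nth d f i t))
  = (pi t +` (seq_mset (map pi f) `\ pi (nth d f i)))%mset.
Proof.
move=> lt_i; apply/msetP => x; rewrite mset1DE msetB1E !mset_seqE.
have {2}-> : f = take i f ++ nth d f i :: drop i.+1 f.
  by rewrite -drop_nth // cat_take_drop.
rewrite set_nthE lt_i !map_cat !count_cat /= addnCA [in RHS]addnCA.
by rewrite ![x == _]eq_sym addKn.
Qed.

Let grafts_Node s a f : perm_eq (grafts s (Node a f))
  (Bplus a (pi s +` seq_mset (map pi f))%mset ::
     flatten [seq regraft a (seq_mset (map pi f)) (pi t, seq_mset (grafts s t))
             | t <- f]).
Proof.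
apply/permP => P; rewrite /grafts /=; congr (_ + _)%N.
  congr (nat_of_bool (P _)); rewrite -BplusE; congr (Bplus a _).
  by apply/msetP => x; rewrite mset1DE !mset_seqE /= eq_sym.
rewrite !count_flatten -!map_comp.
rewrite map_flatten count_flatten -!map_comp size_map.
have mapE (h : ptree A -> nat) :
    map h f = [seq h (nth (Node a f) f i) | i <- iota 0 (size f)].
  rewrite -[in LHS](mkseq_nth (Node a f) f) /mkseq -map_comp.
  exact: eq_map.
rewrite [X in _ = sumn X]mapE.
congr sumn; apply/eq_in_map => i; rewrite mem_iota add0n => /= lt_i.
rewrite -!map_comp (nth_map (Node a f)) // !count_map.
rewrite (permP (perm_eq_seq_mset _)) count_map.
apply: eq_count => v /=; congr (P _).
by rewrite -BplusE seq_mset_set_nth.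
Qed.

Let grafts_pi s s' t t' : pi s = pi s' -> pi t = pi t' ->
  perm_eq (grafts s t) (grafts s' t').
Proof.
move=> ss' tt'; have -> : grafts s t = grafts s' t.
  by apply: eq_map => v; apply: pi_graft_at.
apply/eq_seq_msetP.
pose phi u := (pi u, seq_mset (grafts s' u)).
suff : phi t = phi t' by case.
apply: pi_invariant tt' => a f g fg phifg; congr (_, _).
  by apply/eqP; rewrite ntree_piE eqxx.
apply/eq_seq_msetP; rewrite (permPl (grafts_Node _ _ _)).
rewrite perm_sym (permPl (grafts_Node _ _ _)) perm_sym.
have -> : seq_mset (map pi f) = seq_mset (map pi g) by apply/eq_seq_msetP.
rewrite perm_cons !(map_comp (regraft a _) phi); apply: perm_flatten.
exact: perm_map.
Qed.

(* Grafting of non-planar trees can be computed on any representatives.      *)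
Lemma graft_piE s t :
  graft K (Some (pi s)) (Some (pi t))
  = \sum_(v <- nodes t) << Some (pi (graft_at s v t)) >>.
Proof.
have sumE s' t' : \sum_(v <- nodes t') << Some (pi (graft_at s' v t')) >>
    = \sum_(x <- grafts s' t') << Some x >> :> {malg K[tree A]}.
  by rewrite big_map.
apply: etrans (sumE _ _) _; apply: etrans _ (esym (sumE _ _)).
exact: perm_big (grafts_pi (reprK _) (reprK _)).
Qed.

End GraftRepr.

(* Main.v *)
(* Both sides equal the sum, over the leaves of tau, of (decoration of the    *)
(* leaf) . a(tau without that leaf).  For a(tau), this holds because the      *)
(* first letter of a word of a(tau) comes from a leaf, and removing the first *)
(* letter is a derivation of the shuffle product.  For the adjoint of         *)
(* grafting, it is the identity                                               *)
(*   S(tau) #{v in y : grafting bullet_a at v gives tau}                      *)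
(*   = S(y) #{leaves of tau with decoration a whose removal gives y},         *)
(* proved by induction: below the roots b of tau and y, either bullet_a is    *)
(* added to the forest, or one subtree x of y is exchanged for a subtree z of *)
(* tau, and S(B_+^b(x H)) = (H(x) + 1) S(x) S(H).                             *)

Require Import Defs.
From mathcomp Require Import all_boot all_algebra.
From mathcomp Require Import ring.
From mathcomp Require Import finmap multiset.
From mathcomp.multinomials Require Import monalg.

Import GRing.Theory.
Local Open Scope ring_scope.

Set Implicit Arguments.
Unset Strict Implicit.
Unset Printing Implicit Defensive.

(** Arborification writes the root decoration last, so every word of it starts at a leaf. Sorting
    words by their first letter gives [arbor_prune]: the arborification of a tree is the sum, over
    its leaves, of the leaf's letter followed by the arborification of the tree without that leaf.

    In the adjoint of grafting, [Pbullet] keeps only the terms with a one-node left factor. By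
    [graft_adj_bullet], the coefficient of such a term counts the leaves decorated by the letter
    whose removal leaves the right factor, so both sides are the same sum.

    The adjoint counts nodes of the smaller tree, pruning counts leaves of the larger one. The
    symmetry factors of the inner product make up the difference: this is [graft_coef_prune], whose
    inductive step rests on [sym_forest_swap]. *)

(** * Multiset identities *)

Section Multisets.
Local Open Scope mset_scope.
Variable T : choiceType.
Implicit Types (x y u : T) (F G H : {mset T}).

Lemma msetB1DA x y F : y \in F -> x +` (F `\ y) = (x +` F) `\ y.
Proof. by move=> yF; apply: msetDBA; rewrite msub1set. Qed.

Lemma eq_mset1D x F H : (F == x +` H) = (x \in F) && (F `\ x == H).
Proof.
apply/eqP/andP => [->|[xF /eqP <-]]; last by rewrite msetB1K.
by rewrite mset1D1 msetD1K (eqxx H).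
Qed.

Lemma sum_mset_delta (K : pzSemiRingType) F (phi : T -> K) u :
  (u \notin F -> phi u = 0) ->
  phi u = \sum_(x <- finsupp F) phi x * (u == x)%:R.
Proof.
have [uF _|uF ->//] := boolP (u \in F); last first.
  rewrite big_seq big1 // => x; rewrite msuppE => xF.
  suff /negPf-> : u != x by rewrite mulr0.
  by apply: contraNneq uF => ->.
rewrite (big_fsetD1 u) ?msuppE // (eqxx u) mulr1 big1_fset /= ?addr0 //.
by move=> x; rewrite !inE (eq_sym x) => /andP[/negPf-> _] _; rewrite mulr0.
Qed.

(** The equality forces [u] to lie in [F], so it can be sorted by the distinct elements of [F]; this
    makes the indicators [u == x] appear, whose sums are grafting coefficients. *)
Lemma eq_mset1D_sum (K : pzSemiRingType) F H u :
  (F == u +` H)%:R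
  = \sum_(x <- finsupp F) (F == x +` H)%:R * (u == x)%:R :> K.
Proof.
pose phi x : K := (F == x +` H)%:R.
by apply: (@sum_mset_delta K F phi) => uF; rewrite /phi eq_mset1D (negPf uF).
Qed.

Lemma sum_seq_mset (V : nmodType) (s : seq T) (phi : T -> V) :
  \sum_(x <- s) phi x
  = \sum_(x <- finsupp (seq_mset s)) phi x *+ seq_mset s x.
Proof.
rewrite -(perm_big _ (perm_eq_seq_mset s)) big_mset.
by apply: eq_bigr => x _; rewrite Monoid.iteropE iter_addr_0.
Qed.

End Multisets.

(** * Symmetry factors of forests *)

Section SymmetryFactor.
Local Open Scope mset_scope.
Variable A : choiceType.

(** One more copy of [x] multiplies the factorial of its multiplicity by [(H x).+1] and the power of
    its symmetry factor by [sym_ntree x]. *)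
Lemma sym_forest_cons (x : ntree A) (H : forest A) :
  sym_forest (x +` H) = ((H x).+1 * sym_ntree x * sym_forest H)%N.
Proof.
have sub : (finsupp H `<=` finsupp (x +` H))%fset.
  by apply/fsubsetP => y; rewrite !msuppE; apply: mset1Dr.
have x_in : x \in finsupp (x +` H) by rewrite msuppE mset1D1.
rewrite /sym_forest [in RHS](big_fset_incl _ sub); last first.
  by move=> y _; rewrite msuppE => /mset_eq0P ->.
rewrite !(big_fsetD1 x x_in) /= mset1DE (eqxx x) add1n factS expnS.
rewrite [(_ * _ * (_ * _))%N]mulnACA -mulnA; congr (_ * (_ * _))%N.
rewrite !big_seq; apply: eq_bigr => y; rewrite !inE => /andP[/negPf yx _].
by rewrite mset1DE yx.
Qed.

Lemma sym_forest0 : sym_forest (mset0 : forest A) = 1%N.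
Proof. by rewrite /sym_forest finsupp0 big_seq_fset0. Qed.

Lemma sym_bullet (a : A) : sym_ntree (bullet a) = 1%N.
Proof. by rewrite sym_Bplus sym_forest0. Qed.

Lemma bullet_piE (a : A) : bullet a = \pi_(ntree A)%qT (Node a [::]).
Proof. by rewrite /bullet /Bplus enum_mset0. Qed.

End SymmetryFactor.

(** * Grafting at or below the root *)

Section GraftNode.
Local Open Scope mset_scope.
Variable A : choiceType.
Notation pi := (\pi_(ntree A))%qT.

Lemma seq_mset_set_nth (d : ptree A) f i t : (i < size f)%N ->
  seq_mset (map pi (set_nth d f i t))
  = pi t +` (seq_mset (map pi f) `\ pi (nth d f i)).
Proof.
elim: f i => [|u f IHf] [|i] //= lt_i; rewrite !mset_cons.
  by rewrite msetD1K.
rewrite IHf // -[in RHS]msetB1DA; first by rewrite msetDCA.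
by rewrite (perm_mem (perm_eq_seq_mset _)) map_f ?mem_nth.
Qed.

Lemma sum_graft_at_Node (V : nmodType) (phi : ntree A -> V) s b g :
  \sum_(v <- nodes (Node b g)) phi (pi (graft_at s v (Node b g)))
  = phi (Bplus b (pi s +` seq_mset (map pi g)))
    + \sum_(t <- g) \sum_(v <- nodes t)
        phi (Bplus b (pi (graft_at s v t) +` (seq_mset (map pi g) `\ pi t))).
Proof.
rewrite /= big_cons; congr (_ + _).
  by rewrite -mset_cons -map_cons BplusE.
rewrite size_map big_flatten big_map (big_nth (Node b g)) /index_iota subn0.
rewrite !big_seq; apply: eq_bigr => i; rewrite mem_iota add0n => /= lt_i.
rewrite big_map (nth_map (Node b g)) //; apply: eq_bigr => v _.
by rewrite -BplusE seq_mset_set_nth.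
Qed.

End GraftNode.

Lemma ptree_ind_mem (A : choiceType) (P : ptree A -> Prop) :
  (forall b f, (forall t, t \in f -> P t) -> P (Node b f)) -> forall t, P t.
Proof.
move=> IH; elim/ptree_ind' => b f IHf; apply: IH.
elim: f IHf => [//|u f IHf] /= [Pu /IHf{}IHf] t.
by rewrite inE => /predU1P[->|/IHf].
Qed.

(** * Removing a leaf *)

Section Pruning.
Local Open Scope mset_scope.
Variable A : choiceType.
Notation pi := (\pi_(ntree A))%qT.

Lemma eq_Bplus a b (F G : forest A) :
  (Bplus a F == Bplus b G) = (a == b) && (F == G).
Proof. by apply/eqP/andP => [/Bplus_inj[-> ->]|[/eqP-> /eqP->]]. Qed.

(** A child pruned to nothing leaves the empty forest. The pruning of a single tree is a parameter,
    so that [prune] can recurse through this definition. *)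
Definition prune_children (prn : ptree A -> seq (A * tree A))
    (f : seq (ptree A)) : seq (A * forest A) :=
  [seq (p.1, forest_of_tree p.2 `+` (seq_mset (map pi f) `\ pi t))
  | t <- f, p <- prn t].

(* The pairs (decoration of a leaf, tree without that leaf), one per leaf.    *)
Fixpoint prune (t : ptree A) : seq (A * tree A) :=
  let: Node b f := t in
  if nilp f then [:: (b, None)]
  else [seq (p.1, Some (Bplus b p.2)) | p <- prune_children prune f].

End Pruning.

(** * Arborification as a sum over leaves *)

Section ArborPrune.
Local Open Scope mset_scope.
Variables (K : fieldType) (A : choiceType).
Local Notation TA := {malg K[seq A]}.
Notation pi := (\pi_(ntree A))%qT.

Lemma lin0 (U V : lmodType K) (h : U -> V) : linear h -> h 0 = 0.
Proof.
by move=> lh; rewrite -[X in h X](addNr 0) -scaleN1r lh scaleN1r addNr.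
Qed.

Lemma lin_sum (U V : lmodType K) (h : U -> V) (I : Type) (s : seq I)
    (g : I -> U) :
  linear h -> h (\sum_(i <- s) g i) = \sum_(i <- s) h (g i).
Proof.
move=> lh; elim: s => [|i s IHs]; last by rewrite !big_cons linD // IHs.
by rewrite !big_nil lin0.
Qed.

(** The Leibniz rule for removing the first letter, for factors without an empty-word term. *)
Lemma shuffle_sum_letter (I J : Type) (r : seq I) (s : seq J)
    (a : I -> A) (x : I -> TA) (b : J -> A) (y : J -> TA) :
  let X := \sum_(i <- r) conc (letter K (a i)) (x i) in
  let Y := \sum_(j <- s) conc (letter K (b j)) (y j) in
  shuffle X Y = \sum_(i <- r) conc (letter K (a i)) (shuffle (x i) Y)
              + \sum_(j <- s) conc (letter K (b j)) (shuffle X (y j)).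
Proof.
move=> X Y; rewrite {1}/X (lin_sum _ _ (shuffle_linl Y)).
transitivity (\sum_(i <- r) \sum_(j <- s)
    (conc (letter K (a i)) (shuffle (x i) (conc (letter K (b j)) (y j)))
     + conc (letter K (b j)) (shuffle (conc (letter K (a i)) (x i)) (y j)))).
  apply: eq_bigr => i _; rewrite (lin_sum _ _ (shuffle_linr _)).
  by apply: eq_bigr => j _; rewrite shuffle_letter.
rewrite (eq_bigr _ (fun i _ => big_split _ _ _ _ _)) big_split /=.
congr (_ + _).
  apply: eq_bigr => i _.
  by rewrite (lin_sum _ _ (shuffle_linr _)) (lin_sum _ _ (conc_linr _)).
rewrite exchange_big /=; apply: eq_bigr => j _.
by rewrite (lin_sum _ _ (shuffle_linl _)) (lin_sum _ _ (conc_linr _)).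
Qed.

Lemma arbor_forestD (F G : forest A) :
  arbor_forest K (F `+` G) = shuffle (arbor_forest K F) (arbor_forest K G).
Proof.
apply: etrans (esym (arborificationU _ _)) _.
apply: etrans (arborificationD _ _ _) _.
by congr (shuffle _ _); apply: arborificationU.
Qed.

Lemma arbor_forest_pi (f : seq (ptree A)) :
  arbor_forest K (seq_mset (map pi f))
  = foldr (@shuffle K A) eps (map (@arbor_ptree K A) f).
Proof.
rewrite /arbor_forest (perm_big _ (perm_eq_seq_mset _)) big_map foldrE big_map.
by apply: eq_bigr => t _; apply: arbor_pi.
Qed.

Lemma arbor_forest1 (x : ntree A) : arbor_forest K [mset x] = arbor_ntree K x.
Proof. by rewrite /arbor_forest big_msetn. Qed.

Lemma arbor_ntree_Bplus b (F : forest A) :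
  arbor_ntree K (Bplus b F) = conc (arbor_forest K F) (letter K b).
Proof.
rewrite -arbor_forest1.
apply: etrans (esym (arborificationU _ _)) _.
apply: etrans (arborification_Bplus _ _ _) _.
by congr (conc _ _); apply: arborificationU.
Qed.

Lemma concA : associative (@conc K A).
Proof.
move=> x y z; move: x; apply: linear_ext => [|k p q|u].
- exact: conc_linl.
- by rewrite !conc_linl.
move: y; apply: linear_ext => [k p q|k p q|v].
- by rewrite conc_linl conc_linr.
- by rewrite conc_linr conc_linl.
move: z; apply: linear_ext => [k p q||w].
- by rewrite !conc_linr.
- exact: conc_linr.
by rewrite !concU catA.
Qed.

Lemma arborification_treeU (y : tree A) :
  arborification_tree << y >> = arbor_forest K (forest_of_tree y).
Proof. by rewrite /arborification_tree linextU arborificationU. Qed.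

Lemma arbor_children_prune (f : seq (ptree A)) :
    f <> [::] ->
    (forall t, t \in f -> arbor_ptree K t = \sum_(p <- prune t)
       conc (letter K p.1) (arbor_forest K (forest_of_tree p.2))) ->
  arbor_forest K (seq_mset (map pi f))
  = \sum_(p <- prune_children (@prune A) f)
      conc (letter K p.1) (arbor_forest K p.2).
Proof.
elim: f => // t f IHf _ arborE.
have tE := arborE t (mem_head _ _).
rewrite /prune_children /= mset_cons big_cat /= big_map /= msetD1K.
(* A single child is treated apart: the remaining forest is empty and arborifies to [eps], which has
   no first letter. *)
have [-> | /eqP f_nil] := eqVneq f [::].
  rewrite /= big_nil addr0 msetDC arbor_forestD arbor_forest1 arbor_pi.
  have s0 : seq_mset [::] = mset0 :> forest A.
    by apply/msetP => x; rewrite mset_seqE mset0E.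
  rewrite s0 -arborificationU arborification0 shuffle1x tE.
  by apply: eq_bigr => p _; rewrite msetD0.
have {}IHf := IHf f_nil (fun u uf =>
  arborE u (mem_behead (uf : u \in behead (t :: f)))).
rewrite arbor_forestD arbor_forest1 arbor_pi tE IHf shuffle_sum_letter -IHf -tE.
congr (_ + _); first by apply: eq_bigr => p _; rewrite arbor_forestD.
rewrite /prune_children !big_allpairs_dep /= !big_seq; apply: eq_bigr => u uf.
apply: eq_bigr => p _; rewrite -msetB1DA; last first.
  by rewrite (perm_mem (perm_eq_seq_mset _)) map_f.
by rewrite msetDCA [in RHS]arbor_forestD arbor_forest1 arbor_pi.
Qed.

Lemma arbor_prune (t : ptree A) :
  arbor_ptree K t = \sum_(p <- prune t)
    conc (letter K p.1) (arbor_forest K (forest_of_tree p.2)).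
Proof.
elim/ptree_ind_mem: t => b f IH.
have [-> | f_nil] := eqVneq f [::].
  rewrite /= big_seq1 /= -arborificationU arborification0.
  by rewrite /letter /eps !concU.
rewrite /= (negPf (introN nilP (elimN eqP f_nil))) big_map /=.
rewrite -arbor_forest_pi (arbor_children_prune (elimN eqP f_nil) IH).
rewrite (lin_sum _ _ (conc_linl _)); apply: eq_bigr => p _.
by rewrite arbor_forest1 arbor_ntree_Bplus concA.
Qed.

End ArborPrune.

(** * Grafting a node against pruning a leaf *)

Section GraftCoefficients.
Local Open Scope mset_scope.
Variables (K : fieldType) (charK : [pchar K] =i pred0) (A : choiceType).
Implicit Types (a b c : A) (F G : forest A) (t : ptree A) (x z : ntree A).
Notation pi := (\pi_(ntree A))%qT.

Definition graft_coef a (y : tree A) z : K :=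
  (graft K (Some (bullet a)) y)@_(Some z).

Lemma graft_coef_None a z : graft_coef a None z = (bullet a == z)%:R.
Proof. by rewrite /graft_coef /= mcoeffU. Qed.

Lemma graft_coef_pi a t z :
  graft_coef a (Some (pi t)) z
  = \sum_(v <- nodes t) (pi (graft_at (Node a [::]) v t) == z)%:R.
Proof.
rewrite /graft_coef bullet_piE graft_piE raddf_sum /=.
by apply: eq_bigr => v _; rewrite mcoeffU.
Qed.

(** Grafting at the root adds a child [bullet a]; grafting elsewhere exchanges one of the [G x]
    copies of a child [x] for some [z]. *)
Lemma graft_coef_Bplus a b c F G :
  graft_coef a (Some (Bplus c G)) (Bplus b F)
  = (b == c)%:R * ((F == bullet a +` G)%:R
    + \sum_(x <- finsupp G) (G x)%:R *
        \sum_(z <- finsupp F)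
           (F == z +` (G `\ x))%:R * graft_coef a (Some x) z).
Proof.
have [g ->] : exists g, G = seq_mset (map pi g).
  exists (map repr G); rewrite -map_comp.
  rewrite (eq_map (fun x => reprK x : (pi \o repr) x = id x)) map_id.
  by rewrite seq_mset_id.
rewrite BplusE graft_coef_pi; set M := seq_mset _.
pose phi x : K := (x == Bplus b F)%:R.
rewrite (sum_graft_at_Node phi) /phi -bullet_piE -/M.
have phiE H : (Bplus c H == Bplus b F)%:R = (b == c)%:R * (F == H)%:R :> K.
  by rewrite eq_Bplus -natrM mulnb (eq_sym c) (eq_sym H).
rewrite phiE mulrDr; congr (_ + _).
pose psi x := (b == c)%:R * \sum_(z <- finsupp F)
  (F == z +` (M `\ x))%:R * graft_coef a (Some x) z.
rewrite (eq_bigr (psi \o pi)) => [|t _].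
  rewrite -(big_map pi predT psi) sum_seq_mset mulr_sumr.
  by apply: eq_bigr => x _; rewrite -[LHS]mulr_natl /psi mulrCA.
(* Sorting the nodes by the tree [z] that the child becomes turns the inner count into a grafting
   coefficient. *)
under eq_bigr => v _ do rewrite phiE eq_mset1D_sum.
rewrite -mulr_sumr exchange_big; congr (_ * _).
by apply: eq_bigr => z _; rewrite -mulr_sumr graft_coef_pi.
Qed.

Lemma count_mem_sum (T : eqType) (x : T) s :
  (count_mem x s)%:R = \sum_(y <- s) (y == x)%:R :> K.
Proof.
rewrite -sum1_count natr_sum big_mkcond.
by apply: eq_bigr => y _ /=; case: (y == x).
Qed.

(** Dual to [graft_coef_Bplus]: pruning a child either deletes it, when it is a single node, or
    exchanges it for some [x]. *)
Lemma count_prune_Node a b c f G :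
  (count_mem (a, Some (Bplus c G)) (prune (Node b f)))%:R
  = (b == c)%:R * \sum_(t <- f)
     ((seq_mset (map pi f) `\ pi t == G)%:R
        * (count_mem (a, None) (prune t))%:R
      + \sum_(x <- finsupp G) (G == x +` (seq_mset (map pi f) `\ pi t))%:R
          * (count_mem (a, Some x) (prune t))%:R) :> K.
Proof.
have [-> | f_nil] := eqVneq f [::].
  by rewrite big_nil mulr0 /= xpair_eqE andbF.
rewrite /= (negPf (introN nilP (elimN eqP f_nil))) count_map.
pose pr p := (b == c) && (p == (a, G)).
rewrite (@eq_count _ _ pr) => [|p /=]; last first.
  rewrite !xpair_eqE (inj_eq Some_inj) eq_Bplus andbCA -xpair_eqE.
  by rewrite -surjective_pairing.
have -> : count pr (prune_children (@prune A) f)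
    = ((b == c) * count_mem (a, G) (prune_children (@prune A) f))%N.
  by rewrite /pr; case: (b == c); rewrite ?mul1n //= count_pred0.
rewrite natrM count_mem_sum; congr (_ * _).
rewrite /prune_children big_allpairs_dep; apply: eq_bigr => t _ /=.
set H := _ `\ _; rewrite !count_mem_sum.
rewrite (eq_bigr _ (fun _ _ => congr1 _ (count_mem_sum _ _))).
under [X in _ = _ + X]eq_bigr => x _ do rewrite mulr_sumr.
(* One pruning of [t] at a time: an empty remainder [q] contributes only to the first term, a tree
   only to the second. *)
rewrite exchange_big mulr_sumr -big_split; apply: eq_bigr => -[a' q] _ /=.
rewrite !xpair_eqE; under eq_bigr do rewrite xpair_eqE.
case: (a' == a) => /=; last first.
  by rewrite mulr0 add0r big1 // => x _; rewrite mulr0.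
case: q => [x|] /=; last first.
  rewrite mset0D; apply: etrans (esym (addr0 _)) _.
  congr (_ + _); first exact: esym (mulr1 _).
  by apply/esym; apply: big1 => x _; apply: mulr0.
rewrite (eq_sym _ G); apply: etrans (eq_mset1D_sum K G H x) _.
apply: etrans (esym (add0r _)) _.
by congr (_ + _); exact: esym (mulr0 _).
Qed.

Lemma sym_forestB1 z F : z \in F ->
  (sym_forest F)%:R
  = (F z)%:R * (sym_ntree z)%:R * (sym_forest (F `\ z))%:R :> K.
Proof.
move=> zF; rewrite -{1}(msetB1K zF) sym_forest_cons !natrM.
by congr (_%:R * _ * _); rewrite -[in RHS](msetB1K zF) mset1DE (eqxx z).
Qed.

(** Both indicators say that [F] without [z] and [G] without [x] are the same forest; [sym_forestB1]
    then expresses both symmetry factors through it. *)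
Lemma sym_forest_swap x z F G (g : K) : z \in F -> x \in G ->
  (sym_forest F)%:R * ((G x)%:R * ((F == z +` (G `\ x))%:R * g))
  = (sym_forest G)%:R * ((G == x +` (F `\ z))%:R
      * ((sym_ntree z)%:R * g / (sym_ntree x)%:R)) * (F z)%:R.
Proof.
move=> zF xG.
have -> : (G == x +` (F `\ z)) = (F == z +` (G `\ x)).
  by rewrite (eq_mset1D x) (eq_mset1D z) zF xG; apply: eq_sym.
rewrite (eq_mset1D z) zF.
have [FG|] := eqVneq (F `\ z) (G `\ x); last by rewrite !(mul0r, mulr0).
rewrite (sym_forestB1 zF) (sym_forestB1 xG) FG.
have : (sym_ntree x)%:R != 0 :> K := sym_tree_neq0 (Some x) charK.
move: (sym_forest _)%:R (sym_ntree x)%:R (sym_ntree z)%:R (F z)%:R (G x)%:R.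
by move=> s sx sz Fz Gx sx0; field.
Qed.

(** The two recursions match term by term: a new leaf at the root against a deleted one-node child,
    and exchanges against exchanges by [sym_forest_swap]. *)
Lemma graft_coef_prune a t y :
  (sym_ntree (pi t))%:R * graft_coef a y (pi t)
  = (sym_tree y)%:R * (count_mem (a, y) (prune t))%:R.
Proof.
elim/ptree_ind_mem: t y => b f IH [y|]; last first.
  rewrite graft_coef_None mul1r bullet_piE ntree_piE.
  have [-> | f_nil] := eqVneq f [::].
    by rewrite psym_pi /= big_nil mul1r xpair_eqE eqxx !andbT (eq_sym b) addn0.
  rewrite [perm_eq _ _](_ : _ = false) ?andbF ?mulr0; last first.
    apply: contraNF f_nil => /perm_size/esym.
    by rewrite size_map -size_eq0 => ->.
  rewrite /= (negPf (introN nilP (elimN eqP f_nil))) count_map.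
  rewrite (@eq_count _ _ pred0) ?count_pred0 // => p.
  by rewrite /= xpair_eqE andbF.
have [c [G ->]] := Bplus_surj y.
rewrite /sym_tree -BplusE !sym_Bplus graft_coef_Bplus count_prune_Node.
set M := seq_mset _; rewrite mulrCA [RHS]mulrCA; congr (_ * _).
(* The induction hypothesis, solved for the pruning counts, depends on a child only through its
   class [z]; equal children can then be grouped with multiplicity [M z]. *)
pose psi z : K := (M `\ z == G)%:R * ((sym_ntree z)%:R * (bullet a == z)%:R)
  + \sum_(x <- finsupp G) (G == x +` (M `\ z))%:R
      * ((sym_ntree z)%:R * graft_coef a (Some x) z / (sym_ntree x)%:R).
rewrite [in RHS](eq_big_seq (psi \o pi)) => [|t tf]; last first.
  congr (_ * _ + _).
    by rewrite -graft_coef_None (IH t tf) mul1r.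
  apply: eq_bigr => x _; congr (_ * _); rewrite (IH t tf) /= mulrC mulKf //.
  exact: (sym_tree_neq0 (Some x) charK).
rewrite -(big_map pi predT psi) (sum_seq_mset (map pi f) psi) -/M.
(* The root term is also spread over the distinct children [z], so that the two sides can be
   compared for each [z]. *)
rewrite [X in _ * (X + _)]eq_mset1D_sum.
under [X in _ + X]eq_bigr => x _ do rewrite mulr_sumr.
rewrite exchange_big -big_split !mulr_sumr; apply: eq_big_seq => z.
rewrite msuppE => zM /=; rewrite -[psi z *+ _]mulr_natr mulrA !mulrDr mulrDl.
congr (_ + _).
  rewrite eq_mset1D zM /=; have [MG|_] := eqVneq (M `\ z) G; last first.
    by rewrite !(mul0r, mulr0).
  rewrite (sym_forestB1 zM) MG !mul1r.
  move: (sym_forest _)%:R (sym_ntree z)%:R (M z)%:R (_ == z)%:R => s sz Mz e.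
  by ring.
rewrite !mulr_sumr mulr_suml; apply: eq_big_seq => x; rewrite msuppE => xG.
exact: sym_forest_swap.
Qed.

End GraftCoefficients.

(** * Coefficients of the adjoint and conclusion *)

Lemma linext_eq_coef (K : fieldType) (I : choiceType) (V : lmodType K)
    (h : I -> V) (x y : {malg K[I]}) :
  (forall i, x@_i = y@_i \/ h i = 0) -> linext h x = linext h y.
Proof.
move=> xy; rewrite (linextw _ (fsubsetUl (msupp x) (msupp y))).
rewrite (linextw _ (fsubsetUr (msupp x) (msupp y))).
by apply: eq_bigr => i _; case: (xy i) => ->; rewrite ?scaler0.
Qed.

Lemma inner_coef (K : fieldType) (A : choiceType) (z : tree A)
    (w : {malg K[tree A]}) :
  inner << z >> w = (sym_tree z)%:R * w@_z.
Proof.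
have lin : linear (inner << z >> : {malg K[tree A]} -> K^o).
  exact: bilext_linr.
move: w; apply: (@linear_ext K _ K^o _ (fun w => _ * w@_z) lin) => [k p q|y].
  by rewrite mcoeffD mcoeffZ mulrDr mulrCA.
rewrite innerU /inner_basis mcoeffU (eq_sym y).
by have [->|_] := eqVneq z y; rewrite ?mulr1 ?mul1r // mulr0 mul0r.
Qed.

(** A one-node tree has symmetry factor 1, so adjointness and [graft_coef_prune] give the identity
    multiplied by the symmetry factor of [y], which is invertible in characteristic 0. *)
Lemma graft_adj_bullet (K : fieldType) (charK : [pchar K] =i pred0)
    (A : choiceType) (a : A) (t : ptree A) (y : tree A) :
  (graft_adj K (Some (\pi_(ntree A)%qT t)))@_(Some (bullet a), y)
  = (count_mem (a, y) (prune t))%:R.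
Proof.
have y0 := sym_tree_neq0 y charK; apply: (mulfI y0).
rewrite -(graft_coef_prune charK) /graft_coef.
rewrite -(inner_coef (Some _)) -graft_adjP //.
by rewrite inner2_coef /= sym_bullet mul1r mulrC.
Qed.

Theorem proposition2p3 (K : fieldType) (charK : [pchar K] =i pred0)
    (A : choiceType) (tau : tree A) (tau_nonempty : tau <> None) :
  arborification_tree (<< tau >> : {malg K[tree A]})
  = Mc (tensmap (@Pbullet K A) (@arborification_tree K A) (graft_adj K tau)).
Proof.
case: tau tau_nonempty => [x _|//]; elim/quotW: x => t.
rewrite arborification_treeU arbor_forest1 arbor_pi arbor_prune.
rewrite /tensmap linextE linear_comb; last exact: linext_linear.
rewrite -linextE.
(* The part of the adjoint that [Pbullet] does not kill; elsewhere the coefficients are irrelevant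
   by [linext_eq_coef]. *)
pose leaves : {malg K[(tree A * tree A)%type]} :=
  \sum_(q <- prune t) << (Some (bullet q.1), q.2) >>.
rewrite (@linext_eq_coef _ _ _ _ _ leaves) => [|[[x|] y]] /=; last first.
- by right; rewrite Pbullet0 //; exact: lin0 (conc_linl _).
- have [->|xE] := eqVneq x (bullet (nroot x)).
    left; rewrite graft_adj_bullet // count_mem_sum raddf_sum.
    apply: eq_bigr => -[a z] _; rewrite /= mcoeffU !xpair_eqE.
    by rewrite (inj_eq Some_inj) /bullet eq_Bplus eqxx andbT.
  right; rewrite Pbullet0 => [|a [xa]]; first exact: lin0 (conc_linl _).
  by rewrite xa nroot_Bplus eqxx in xE.
rewrite lin_sum; last exact: linext_linear.
apply: eq_bigr => q _.
by rewrite linextU PbulletE arborification_treeU.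
Qed.
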